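(* Let $L\ge1$, $N=2L+1$, $s>0$, and $\beta_{\ell,1}=\beta_{\ell,2}=\ell^s$ for $1\le\ell\le L$, $\beta_{0,1}=0$. Let $f^\epsilon\in C(\mathbb{S}^1)$ be a noisy function with noise vector $\epsilon=(\epsilon_1,\dots,\epsilon_N)^T\in\mathbb{R}^N$, and let $\lambda_{\rm mor}>0$ be a root of the discrepancy function $$F(\lambda)=\frac{2\pi}{N}\sum_{j=1}^N\big[\mathcal U^\beta_{\lambda,L,N}f^\epsilon(x_j)-f^\epsilon(x_j)\big]^2-\frac{2\pi}{N}\sum_{j=1}^N\epsilon_j^2 .$$ Then $$\|\mathcal U^\beta_{\lambda_{\rm mor},L,N}f^\epsilon-\mathcal U_{0,L,N}f^\epsilon\|_\infty\le\sqrt{(2L+1)2\pi}\;\|\epsilon\|_\infty .$$ That is, Morozov's discrepancy principle is a regular parameter choice strategy (as $\|\epsilon\|_\infty\to0$).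
   Context: Points $x=(\cos\theta,\sin\theta)^T$ of the unit circle $\mathbb{S}^1$ are identified with angles $\theta\in[-\pi,\pi]$ (mod $2\pi$). $C(\mathbb{S}^1)$ is the space of real continuous functions on $\mathbb{S}^1$; $\|g\|_\infty=\max_{\mathbb{S}^1}|g|$ for functions and $\|\epsilon\|_\infty=\max_j|\epsilon_j|$ for vectors. The noisy values are $f^\epsilon(x_j)=f(x_j)+\epsilon_j$ for an underlying $f\in C(\mathbb{S}^1)$. Put $Y_{0,1}=1/\sqrt{2\pi}$, $Y_{\ell,1}(x)=\cos(\ell\theta)/\sqrt\pi$, $Y_{\ell,2}(x)=\sin(\ell\theta)/\sqrt\pi$ for $\ell\ge1$; $\gamma_0=0$ and $\gamma_\ell=1$ for $\ell\ge1$. The points $x_1,\dots,x_N\in\mathbb{S}^1$ are equidistant with angular step $2\pi/N$ (trapezoidal rule nodes), and $\langle v,z\rangle_N=\frac{2\pi}{N}\sum_{j=1}^Nv(x_j)z(x_j)$. The operators are $$\mathcal U^\beta_{\lambda,L,N}g(x)=\sum_{\ell=0}^L\sum_{k=1}^{\gamma_\ell+1}\frac{\langle g,Y_{\ell,k}\rangle_N}{1+\lambda\beta_{\ell,k}^2}Y_{\ell,k}(x),\qquad \mathcal U_{0,L,N}g(x)=\sum_{\ell=0}^L\sum_{k=1}^{\gamma_\ell+1}\langle g,Y_{\ell,k}\rangle_NY_{\ell,k}(x).$$ A parameter choice strategy yielding $\lambda_{\rm reg}$ is called regular if $\|\mathcal U^\beta_{\lambda_{\rm reg},L,N}f^\epsilon-\mathcal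 U_{0,L,N}f^\epsilon\|_\infty\le C\|\epsilon\|_\infty$ with a bounded constant $C$ independent of the noise $\epsilon$. *)

(* Defs.v *)
From mathcomp Require Import all_boot all_order all_algebra.
From mathcomp Require Import all_classical all_reals all_analysis.
Import Order.TTheory GRing.Theory Num.Theory.
Import numFieldNormedType.Exports.

Set Implicit Arguments.
Unset Strict Implicit.
Unset Printing Implicit Defensive.

Local Open Scope classical_set_scope.
Local Open Scope ring_scope.

(* A point (cos t, sin t) of the unit circle is represented by an angle t,
   taken modulo 2 pi, so a function on the circle is a 2 pi-periodic function
   R -> R. *)

Definition C_circle (R : realType) (g : R -> R) : Prop :=
  continuous g /\ periodic g (2 * pi).

Definition circle_norm (R : realType) (g : R -> R) : R :=
  sup [set `|g t| | t in `[- pi, pi]].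

(* Nodes with angular step 2 pi / N; the position of the first node is
   arbitrary, and angles are compared modulo 2 pi. *)
Definition equidistant (R : realType) (N : nat) (x : 'I_N -> R) : Prop :=
  forall i j : 'I_N, exists m : int,
    x j - x i = (j%:R - i%:R) * (2 * pi / N%:R) + m%:~R * (2 * pi).

(* Degree l, order k, where 1 <= k <= gamma l + 1. *)
Definition Y (R : realType) (l k : nat) (t : R) : R :=
  if l == 0%N then 1 / Num.sqrt (2 * pi)
  else if k == 1%N then cos (l%:R * t) / Num.sqrt pi
  else sin (l%:R * t) / Num.sqrt pi.

Definition gamma (l : nat) : nat := if l == 0%N then 0%N else 1%N.

Definition dotN (R : realType) (N : nat) (x : 'I_N -> R) (v z : R -> R) : R :=
  2 * pi / N%:R * \sum_(j < N) v (x j) * z (x j).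

Definition U (R : realType) (L N : nat) (x : 'I_N -> R)
    (beta : nat -> nat -> R) (lambda : R) (g : R -> R) (t : R) : R :=
  \sum_(0 <= l < L.+1) \sum_(1 <= k < (gamma l).+2)
    dotN x g (Y l k) / (1 + lambda * beta l k ^+ 2) * Y l k t.

Definition U0 (R : realType) (L N : nat) (x : 'I_N -> R) (g : R -> R) (t : R)
    : R :=
  \sum_(0 <= l < L.+1) \sum_(1 <= k < (gamma l).+2)
    dotN x g (Y l k) * Y l k t.

Definition noisy_version (R : realType) (N : nat) (x : 'I_N -> R)
    (f : R -> R) (eps : 'cV[R]_N) (fe : R -> R) : Prop :=
  C_circle fe /\ forall j : 'I_N, fe (x j) = f (x j) + eps j 0.

(* [strategy fe eps lambda] means that lambda is a parameter the strategy may
   select from the noisy function fe with noise vector eps.  The norm of a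
   column vector is the maximum norm (lemma mx_normrE). *)
Definition regular_strategy (R : realType) (L N : nat) (x : 'I_N -> R)
    (beta : nat -> nat -> R)
    (strategy : (R -> R) -> 'cV[R]_N -> R -> Prop) : Prop :=
  forall f : R -> R, C_circle f ->
  exists C : R, forall (eps : 'cV[R]_N) (fe : R -> R) (lambda : R),
    noisy_version x f eps fe -> strategy fe eps lambda ->
    circle_norm (fun t => U L x beta lambda fe t - U0 L x fe t) <= C * `|eps|.

Definition discrepancy (R : realType) (L N : nat) (x : 'I_N -> R)
    (beta : nat -> nat -> R) (fe : R -> R) (eps : 'cV[R]_N) (lambda : R) : R :=
  2 * pi / N%:R * \sum_(j < N) (U L x beta lambda fe (x j) - fe (x j)) ^+ 2
  - 2 * pi / N%:R * \sum_(j < N) eps j 0 ^+ 2.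

Definition morozov (R : realType) (L N : nat) (x : 'I_N -> R)
    (beta : nat -> nat -> R) (fe : R -> R) (eps : 'cV[R]_N) (lambda : R)
    : Prop :=
  0 < lambda /\ discrepancy L x beta fe eps lambda = 0.

(* Main.v *)
Require Import Defs.
From mathcomp Require Import all_boot all_order all_algebra.
From mathcomp Require Import all_classical all_reals all_analysis.
From mathcomp Require Import ring lra zify.
Import Order.TTheory GRing.Theory Num.Theory.
Import numFieldNormedType.Exports.
Local Open Scope classical_set_scope.
Local Open Scope ring_scope.

(** The difference [p] between the regularized and the unregularized
    approximation of the noisy function is a trigonometric polynomial of degree
    at most [L], i.e. a combination of [N = 2L + 1] basis functions.

    On the [N] equidistant nodes these basis functions are orthonormal for the
    discrete inner product: the square matrix of node values has orthogonal rows
    ([sampling_orthogonal]) because the Dirichlet kernel vanishes at differences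
    of distinct nodes ([dirichlet_node]), and for a square matrix the columns
    are then orthogonal too.  This has two consequences.  The unregularized
    operator interpolates ([U0_interpolates]), so at the nodes [p] equals the
    residual of the regularized approximation, and the discrepancy principle
    says that the squares of these values have the same sum as the squares of
    the noise, at most [N] times the square of its maximum norm.  Moreover
    Parseval's identity holds at the nodes ([parseval_nodes]), so
    Cauchy-Schwarz bounds [p t ^ 2] at every angle [t] by the sum of the squares
    of the node values of [p] ([trig_sum_le]).

    Together, [|p t| <= sqrt N * |eps|], which is stronger than the claim by the
    factor [sqrt (2 pi)]. *)

(** The Cauchy-Schwarz inequality; by Lagrange's identity the gap, counted
    twice, is a sum of squares. *)
Lemma sqr_sum_mul_le (F : realDomainType) (I : finType) (a b : I -> F) :
  (\sum_i a i * b i) ^+ 2 <= (\sum_i a i ^+ 2) * (\sum_i b i ^+ 2).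
Proof.
have lagrange : (\sum_i a i ^+ 2) * (\sum_i b i ^+ 2) *+ 2
    - (\sum_i a i * b i) ^+ 2 *+ 2
    = \sum_i \sum_j (a i * b j - a j * b i) ^+ 2.
  under [RHS]eq_bigr => i _.
    under eq_bigr => j _.
      rewrite (_ : _ ^+ 2 = a i ^+ 2 * b j ^+ 2 + b i ^+ 2 * a j ^+ 2
                            - (a i * b i) * (a j * b j) *+ 2); last by ring.
      over.
    rewrite sumrB big_split /= sumrMnl -!mulr_sumr.
    over.
  rewrite sumrB big_split /= sumrMnl -!mulr_suml.
  ring.
rewrite -(ler_pMn2r (n := 2)) // -subr_ge0 lagrange.
by apply: sumr_ge0 => i _; apply: sumr_ge0 => j _; exact: sqr_ge0.
Qed.

(** * The Dirichlet kernel *)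

Definition dirichlet {R : realType} (L : nat) (t : R) : R :=
  1 + 2 * \sum_(1 <= l < L.+1) cos (l%:R * t).

(** The sum telescopes once multiplied by [sin (t / 2)], because
    [2 sin a cos b = sin (b + a) - sin (b - a)]. *)
Lemma sin_half_dirichlet (R : realType) (L : nat) (t : R) :
  sin (t / 2) * dirichlet L t = sin ((2 * L).+1%:R * (t / 2)).
Proof.
rewrite /dirichlet; elim: L => [|L IH].
  by rewrite big_geq // mulr0 addr0 mulr1 muln0 mul1r.
rewrite big_nat_recr //= [2 * _]mulrDr addrA mulrDr IH.
have -> : (2 * L).+1%:R * (t / 2) = L.+1%:R * t - t / 2.
  by rewrite -!natr1 natrM; field.
have -> : (2 * L.+1).+1%:R * (t / 2) = L.+1%:R * t + t / 2.
  by rewrite -[(2 * L.+1).+1%:R]natr1 natrM; field.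
by rewrite sinB sinD; ring.
Qed.

Lemma sin_natr_pi (R : realType) (n : nat) : sin (n%:R * pi) = 0 :> R.
Proof.
elim: n => [|n IH]; first by rewrite mul0r sin0.
by rewrite -natr1 mulrDl mul1r sinD IH sinpi mul0r mulr0 addr0.
Qed.

Lemma cosD_intr_2pi (R : realType) (m : int) (t : R) :
  cos (t + m%:~R * (2 * pi)) = cos t.
Proof.
have cosDn (n : nat) (u : R) : cos (u + n%:R * (2 * pi)) = cos u.
  by rewrite -[RHS](periodicn (@cosD2pi R) n u) (mulr_natl _ n) (mulr_natl pi).
case: m => n; first exact: cosDn.
by rewrite NegzE mulrNz mulNr -[LHS](cosDn n.+1) subrK.
Qed.

(** With [N = 2L + 1] the closed form at the angle [2 pi d / N] has numerator
    [sin (d pi) = 0] and denominator [sin (d pi / N)], which is nonzero when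
    [0 < |d| < N]. *)
Lemma dirichlet_node (R : realType) (L : nat) (d m : int) :
  (0 < `|d| < (2 * L).+1)%N ->
  dirichlet L (d%:~R * (2 * pi / (2 * L).+1%:R) + m%:~R * (2 * pi)) = 0 :> R.
Proof.
move=> /andP[d_gt0 d_ltN]; set N := (2 * L).+1 in d_ltN *.
have N0 : N%:R != 0 :> R by rewrite pnatr_eq0.
have -> : dirichlet L (d%:~R * (2 * pi / N%:R) + m%:~R * (2 * pi))
          = dirichlet L (`|d|%N%:R * (2 * pi / N%:R)) :> R.
  (* The kernel is even and 2 pi-periodic, so the sign of d and the multiple
     of 2 pi can be dropped. *)
  congr (1 + 2 * _); apply: eq_bigr => l _.
  rewrite mulrDr -[X in cos X]addrC addrC mulrA.
  have -> : l%:R * (m%:~R * (2 * pi)) = (l%:Z * m)%:~R * (2 * pi) :> R.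
    by rewrite intrM mulrA.
  rewrite cosD_intr_2pi -cos_norm -[in RHS]cos_norm !normrM !normr_nat.
  by rewrite -intr_norm -abszE !mulrA.
have half : `|d|%N%:R * (2 * pi / N%:R) / 2 = `|d|%N%:R * pi / N%:R :> R.
  by field.
have := sin_half_dirichlet R L (`|d|%N%:R * (2 * pi / N%:R)).
rewrite half -/N mulrC (mulrC N%:R) divfK // sin_natr_pi => /eqP.
rewrite mulf_eq0 => /orP[/eqP //|/eqP sin0].
suff : 0 < sin (`|d|%N%:R * pi / N%:R) :> R by rewrite sin0 ltxx.
apply: sin_gt0_pi; rewrite divr_gt0 ?mulr_gt0 ?ltr0n ?pi_gt0 //=.
by rewrite ltr_pdivrMr ?ltr0n // mulrC ltr_pM2l ?pi_gt0 // ltr_nat.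
Qed.

(** * The trigonometric basis sampled at the nodes *)

(** The functions [Y l k] in the order [Y 0 1, Y 1 1, Y 1 2, Y 2 1, ...].  A
    single index makes the matrix of node values square, so that a one-sided
    inverse is two-sided. *)
Definition Yn (R : realType) (i : nat) (t : R) : R :=
  Y (uphalf i) (odd i.-1).+1 t.
Arguments Yn {R}.

Lemma sum_degree_order (V : nmodType) (L : nat) (G : nat -> nat -> V) :
  \sum_(0 <= l < L.+1) \sum_(1 <= k < (gamma l).+2) G l k
  = \sum_(i < (2 * L).+1) G (uphalf i) (odd i.-1).+1.
Proof.
elim: L => [|L IH]; first by rewrite big_nat1 big_nat1 muln0 big_ord1.
rewrite big_nat_recr //= IH mulnS !big_ord_recr /= /gamma /=.
rewrite [X in _ + X]big_nat_recr // big_nat1 /= !mul2n addrA.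
by rewrite odd_double /= uphalf_double doubleK.
Qed.

(** The addition theorem: [cos (l t) cos (l u) + sin (l t) sin (l u)] is
    [cos (l (t - u))]. *)
Lemma sum_YnM (R : realType) (L : nat) (t u : R) :
  \sum_(i < (2 * L).+1) Yn i t * Yn i u = dirichlet L (t - u) / (2 * pi).
Proof.
rewrite -(sum_degree_order _ _ (fun l k => Y l k t * Y l k u)).
rewrite big_nat_recl // big_nat1 /Y /= -expr2 expr_div_n expr1n.
rewrite sqr_sqrtr ?mulr_ge0 ?pi_ge0 // /dirichlet big_add1 /=.
rewrite [RHS]mulrDl; congr (_ + _).
rewrite -mulf_div divff ?pnatr_eq0 // mul1r mulr_suml; apply: eq_bigr => l _.
rewrite /gamma /= big_nat_recr // big_nat1 /= mulrBr cosB.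
by rewrite !mulf_div -expr2 sqr_sqrtr ?pi_ge0 // -mulrDl.
Qed.

Lemma sum_Yn_sqr (R : realType) (L : nat) (t : R) :
  \sum_(i < (2 * L).+1) Yn i t ^+ 2 = (2 * L).+1%:R / (2 * pi).
Proof.
under eq_bigr do rewrite expr2.
rewrite sum_YnM subrr /dirichlet; congr (_ / _).
under eq_bigr do rewrite mulr0 cos0.
by rewrite big_add1 /= big_mkord sumr_const card_ord addrC -natrM natr1.
Qed.

Definition sampling {R : realType} {L : nat} (x : 'I_(2 * L).+1 -> R) :
  'M[R]_((2 * L).+1) := \matrix_(j, i) Yn i (x j).

(** Orthogonality of the rows: the entries of the product are values of the
    Dirichlet kernel at differences of nodes.  Orthogonality of the columns,
    which is the discrete orthonormality of the basis, then comes for free. *)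
Lemma sampling_orthogonal (R : realType) (L : nat) (x : 'I_(2 * L).+1 -> R) :
  equidistant x ->
  (2 * pi / (2 * L).+1%:R) *: (sampling x *m (sampling x)^T) = 1%:M.
Proof.
move=> hx; apply/matrixP => i j; rewrite !mxE.
under eq_bigr do rewrite !mxE.
have [<-|ij] := eqVneq i j.
  under eq_bigr do rewrite -expr2.
  rewrite sum_Yn_sqr -invf_div mulVf //.
  by rewrite gt_eqF // divr_gt0 ?mulr_gt0 ?pi_gt0.
rewrite sum_YnM; have [m ->] := hx j i.
rewrite (pmulrn 1 i) (pmulrn 1 j) -intrB dirichlet_node ?mul0r ?mulr0 //.
rewrite absz_gt0 subr_eq0 eqz_nat ij /=.
by have := ltn_ord i; have := ltn_ord j; lia.
Qed.

(** The quadrature is exact on squares of trigonometric polynomials of degree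
    at most [L]: this is orthogonality of the columns of the sampling matrix. *)
Lemma parseval_nodes (R : realType) (L : nat) (x : 'I_(2 * L).+1 -> R)
    (c : 'I_(2 * L).+1 -> R) :
  equidistant x ->
  2 * pi / (2 * L).+1%:R
    * \sum_(j < (2 * L).+1) (\sum_(i < (2 * L).+1) c i * Yn i (x j)) ^+ 2
  = \sum_(i < (2 * L).+1) c i ^+ 2.
Proof.
move=> hx; set w := _ / _.
have BtB : (w *: (sampling x)^T) *m sampling x = 1%:M.
  by apply: mulmx1C; rewrite -scalemxAr sampling_orthogonal.
pose v : 'cV[R]_((2 * L).+1) := \col_i c i.
have val j : (sampling x *m v) j 0 = \sum_i c i * Yn i (x j).
  by rewrite mxE; apply: eq_bigr => i _; rewrite !mxE mulrC.
transitivity ((v^T *m ((w *: (sampling x)^T) *m sampling x) *m v) 0 0).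
  rewrite -scalemxAl -scalemxAr -scalemxAl -!mulmxA mulmxA -trmx_mul mxE mxE.
  by congr (_ * _); apply: eq_bigr => j _; rewrite mxE val expr2.
by rewrite BtB mulmx1 mxE; apply: eq_bigr => i _; rewrite !mxE expr2.
Qed.

(** There are as many basis functions as nodes, so the discrete projection
    loses nothing at the nodes: its values there are obtained from those of [g]
    by the matrix of [sampling_orthogonal]. *)
Lemma U0_interpolates (R : realType) (L : nat) (x : 'I_(2 * L).+1 -> R)
    (g : R -> R) (j : 'I_(2 * L).+1) :
  equidistant x -> U0 L x g (x j) = g (x j).
Proof.
move=> hx; rewrite /U0 (sum_degree_order _ _ (fun l k => _ * _)).
pose v : 'cV[R]_((2 * L).+1) := \col_j g (x j).
transitivity (((2 * pi / (2 * L).+1%:R)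
                *: (sampling x *m (sampling x)^T) *m v) j 0); last first.
  by rewrite sampling_orthogonal // mul1mx mxE.
rewrite -scalemxAl -mulmxA mxE mxE mulr_sumr; apply: eq_bigr => i _.
rewrite /dotN -mulrA; congr (_ * _); rewrite mulrC !mxE; congr (_ * _).
by apply: eq_bigr => k _; rewrite !mxE mulrC.
Qed.

(** Bounds a trigonometric polynomial everywhere by its node values.
    Cauchy-Schwarz costs the factor [sum_Yn_sqr], which is the reciprocal of
    the quadrature weight and so cancels the weight in Parseval's identity. *)
Lemma trig_sum_le (R : realType) (L : nat) (x : 'I_(2 * L).+1 -> R)
    (c : 'I_(2 * L).+1 -> R) (t : R) :
  equidistant x ->
  (\sum_(i < (2 * L).+1) c i * Yn i t) ^+ 2
  <= \sum_(j < (2 * L).+1) (\sum_(i < (2 * L).+1) c i * Yn i (x j)) ^+ 2.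
Proof.
move=> hx; apply: le_trans (sqr_sum_mul_le _ _ _ _) _.
rewrite -(parseval_nodes _ _ _ c hx) sum_Yn_sqr mulrAC.
rewrite -invf_div mulVf ?mul1r //.
by rewrite gt_eqF // divr_gt0 ?mulr_gt0 ?pi_gt0.
Qed.

Lemma coord_le_mx_norm (R : realType) (n : nat) (v : 'cV[R]_n) (j : 'I_n) :
  `|v j 0| <= `|v|.
Proof.
rewrite [leRHS]mx_normrE.
exact: (le_bigmax _ (fun ij : 'I_n * 'I_1 => `|v ij.1 ij.2|) (j, 0)).
Qed.

(** * The error bound for the discrepancy principle *)

Theorem corollary5p1 (R : realType) (L N : nat) (s : R)
    (beta : nat -> nat -> R) (x : 'I_N -> R)
    (hL : (1 <= L)%N) (hN : N = (2 * L + 1)%N) (hs : 0 < s)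
    (hbeta0 : beta 0%N 1%N = 0)
    (hbeta : forall l : nat, (1 <= l <= L)%N ->
       beta l 1%N = l%:R `^ s /\ beta l 2%N = l%:R `^ s)
    (hx : equidistant x) :
  (forall (f fe : R -> R) (eps : 'cV[R]_N) (lambda_mor : R),
     C_circle f -> noisy_version x f eps fe ->
     0 < lambda_mor -> discrepancy L x beta fe eps lambda_mor = 0 ->
     circle_norm (fun t => U L x beta lambda_mor fe t - U0 L x fe t)
       <= Num.sqrt ((2 * L%:R + 1) * (2 * pi)) * `|eps|)
  /\ regular_strategy L x beta (morozov L x beta).
Proof.
rewrite addn1 in hN; subst N.
suff bound fe (eps : 'cV[R]_((2 * L).+1)) lambda :
    discrepancy L x beta fe eps lambda = 0 ->
    circle_norm (fun t => U L x beta lambda fe t - U0 L x fe t)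
      <= Num.sqrt ((2 * L%:R + 1) * (2 * pi)) * `|eps|.
  split=> [f fe eps lambda _ _ _|f _]; first exact: bound.
  exists (Num.sqrt ((2 * L%:R + 1) * (2 * pi))) => eps fe lambda _ [_].
  exact: bound.
have w_gt0 : 0 < 2 * pi / (2 * L).+1%:R :> R.
  by rewrite divr_gt0 ?mulr_gt0 ?pi_gt0 ?ltr0n.
move=> /eqP; rewrite /discrepancy -mulrBr mulf_eq0 gt_eqF //= subr_eq0.
move=> /eqP residual.
pose c (i : 'I_(2 * L).+1) :=
  dotN x fe (Yn i) / (1 + lambda * beta (uphalf i) (odd i.-1).+1 ^+ 2)
  - dotN x fe (Yn i).
have diffE t : U L x beta lambda fe t - U0 L x fe t = \sum_i c i * Yn i t.
  rewrite /U /U0 (sum_degree_order _ _ (fun l k => _ / _ * Y l k t)).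
  rewrite (sum_degree_order _ _ (fun l k => dotN x fe (Y l k) * Y l k t)).
  by rewrite -sumrB; apply: eq_bigr => i _; rewrite -mulrBl.
apply: ge_sup.
  by exists `|U L x beta lambda fe 0 - U0 L x fe 0|, 0;
     rewrite // /= in_itv /= oppr_le0 !pi_ge0.
move=> _ [t _ <-]; rewrite -sqrtr_sqr (_ : `|eps| = Num.sqrt (`|eps| ^+ 2));
  last by rewrite sqrtr_sqr normr_id.
rewrite -sqrtrM ?ler_wsqrtr ?mulr_ge0 ?pi_ge0 // ?addr_ge0 ?mulr_ge0 //.
rewrite diffE; apply: le_trans (trig_sum_le _ _ _ _ _ hx) _.
(* At the nodes the difference is the residual that the discrepancy principle
   equates with the noise. *)
under eq_bigr do rewrite -diffE U0_interpolates //.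
rewrite residual.
have sum_le :
    \sum_(j < (2 * L).+1) eps j 0 ^+ 2 <= (2 * L%:R + 1) * `|eps| ^+ 2.
  rewrite -natrM natr1 mulr_natl -[X in _ *+ X]card_ord -sumr_const.
  apply: ler_sum => j _; rewrite -real_normK ?num_real //.
  by rewrite lerXn2r ?nnegrE // coord_le_mx_norm.
apply: le_trans sum_le _; rewrite mulrAC ler_peMr ?mulr_ge0 ?addr_ge0 //.
by have := pi_ge2 R; lra.
Qed.
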